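(* Let $n$ be a positive integer divisible by $4$, let $d=n/2$, and for $1\le i\le d$ let $$c_i=\begin{cases} i, & i \text{ odd}\\ d-i, & i\text{ even.}\end{cases}$$ Then every $x\in STSP(n)$ satisfies the circlet inequality $$\sum_{i=1}^d c_i t_i\ \ge\ n-2,$$ where $t_i=t_i(x)$ denotes the total weight that $x$ places on edges of length $i$. That is, the circlet inequalities are valid for the symmetric TSP polytope.
   Context: $K_n=([n],E)$ is the complete undirected graph on the vertex set $[n]=\{1,\dots,n\}$. For a Hamiltonian cycle $H$ on $K_n$, $\chi_H\in\{0,1\}^{E}$ is its edge-incidence vector. The symmetric Traveling Salesman Problem polytope is $STSP(n)=\mathrm{conv}\{\chi_H: H\text{ is a Hamiltonian cycle on }K_n\}\subset\mathbb{R}^{E}$. The length of an edge $\{i,j\}$ is $\ell_{i,j}=\min\{|i-j|,\,n-|i-j|\}$. For $x\in\mathbb{R}^{E}$ and $1\le i\le d$, $t_i=\sum_{\{s,t\}\in E:\ \ell_{s,t}=i}x_{s,t}$. *)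

(* Defs.v *)
From mathcomp Require Import all_boot all_order all_algebra.
From mathcomp Require Import classical_sets reals.

Set Implicit Arguments.
Unset Strict Implicit.
Unset Printing Implicit Defensive.

Import Order.TTheory GRing.Theory Num.Theory.
Local Open Scope ring_scope.

(* The vertex i : 'I_n stands for the vertex i + 1 of [n]; the shift leaves
   all the differences |i - j| unchanged. *)
Definition complete_graph (n : nat) : rel 'I_n := fun u v => u != v.

Notation edge n := {e : {set 'I_n} | #|e| == 2%N}.

(* R^o is R viewed as a module over itself; it makes the functions on edges an
   R-module. *)
Notation edge_vector R n := {ffun edge n -> R^o}.

Definition hamiltonian_cycle (n : nat) (H : {set edge n}) : Prop :=
  exists p : seq 'I_n,
    [/\ (2 < size p)%N,
        ucycle (@complete_graph n) p,
        forall v : 'I_n, v \in p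
      & H = [set e : edge n | [exists v : 'I_n, val e == [set v; next p v]]]].

Definition incidence (R : realType) (n : nat) (H : {set edge n}) :
    edge_vector R n :=
  [ffun e => (e \in H)%:R].

Definition convex_hull (R : realType) (V : lmodType R) (S : set V) : set V :=
  fun x => exists (m : nat) (a : 'I_m -> R) (v : 'I_m -> V),
    [/\ forall i, 0 <= a i,
        \sum_(i < m) a i = 1,
        forall i, S (v i)
      & x = \sum_(i < m) a i *: v i].

Definition STSP (R : realType) (n : nat) : set (edge_vector R n) :=
  @convex_hull R (edge_vector R n)
    (fun x => exists2 H : {set edge n}, hamiltonian_cycle H & x = incidence R H).

Definition vertex_dist (n : nat) (i j : 'I_n) : nat :=
  minn `|i%:Z - j%:Z|%N (n - `|i%:Z - j%:Z|%N).

Definition has_length (n : nat) (e : edge n) (k : nat) : bool :=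
  [exists i : 'I_n, exists j : 'I_n,
     (val e == [set i; j]) && (vertex_dist i j == k)].

Definition length_weight (R : realType) (n : nat) (x : edge_vector R n)
    (k : nat) : R :=
  \sum_(e : edge n | has_length e k) x e.

Definition circlet_coef (R : realType) (d i : nat) : R :=
  if odd i then i%:R else d%:R - i%:R.

(* Main.v *)
Require Import Defs.
From mathcomp Require Import all_boot all_order all_algebra.
From mathcomp Require Import classical_sets reals.
From mathcomp Require Import zify ring.

Import Order.TTheory GRing.Theory Num.Theory.
Local Open Scope ring_scope.

(** Write n = 2d. The inequality is linear in x, so it suffices to prove it
    for a single Hamiltonian cycle v_0, v_1, ..., v_n = v_0.

    The coefficients have a geometric meaning on the circle Z/2d: an edge uv
    of odd length costs the circular distance from u to v, and an edge of even
    length costs the distance from u to the antipode v + d. So the tour can be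
    redrawn as a walk W on the integers in which the k-th step has absolute
    value equal to the cost of the k-th edge ([norm_antipodal_step]), each
    edge of even length being followed by a switch to antipodes.

    Whether an edge switches is decided by the parity of v_{k+1} - v_k, and d
    times an integer depends modulo 2d only on its parity. Hence the k-th step
    is congruent modulo 2d to the affine expression
    (1 + d) (v_{k+1} - v_k) + d ([antipodal_step_mod]), and summing gives
        W_k - W_0 = (1 + d) (v_k - v_0) + d k   modulo 2d.
    Two consequences: W_n = W_0 modulo 2d, since v_n = v_0 and n is even; and
    W_k - W_0 = v_k - v_0 modulo d, so W meets every residue class modulo d.

    If W_n differs from W_0, the total cost is at least
    |W_n - W_0| >= 2d = n. Otherwise W is a closed walk on the integers; as it
    meets every class modulo d, its maximum and minimum differ by at least
    d - 1 ([spread_of_covering]), and a closed walk must travel that distance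
    both ways ([closed_walk_length_ge]), so the cost is at least
    2 (d - 1) = n - 2. *)

(** * Walks on the integers *)

Lemma telescope_norm (W : nat -> int) {a b : nat} : (a <= b)%N ->
  `|W b - W a| <= \sum_(a <= k < b) `|W k.+1 - W k|.
Proof. by move=> le_ab; rewrite -telescope_sumr //; exact: ler_norm_sum. Qed.

(** The two arcs of the closed walk between times i and j each have length at
    least the distance of their common endpoints. *)
Lemma closed_walk_length_ge {W : nat -> int} {N i j : nat} :
  W N = W 0%N -> (i <= N)%N -> (j <= N)%N ->
  2 * `|W j - W i| <= \sum_(0 <= k < N) `|W k.+1 - W k|.
Proof.
move=> closedW; wlog le_ij : i j / (i <= j)%N => [wlog_ij | _ le_jN].
  move=> iN jN; case: (leqP i j) => [|/ltnW] ij; first exact: wlog_ij.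
  by rewrite distrC; exact: wlog_ij.
rewrite (@big_cat_nat _ _ _ j) //= (@big_cat_nat _ _ _ i 0%N j) //=.
have := telescope_norm W (leq0n i); have := telescope_norm W le_ij.
have := telescope_norm W le_jN; rewrite closedW.
move: (\sum_(j <= _ < _) _ : int) (\sum_(i <= _ < _) _ : int).
move: (\sum_(0 <= _ < _) _ : int) => a b c /=.
lia.
Qed.

(** Starting from a minimum W i, some W j lies in the class of W i - 1; being
    at least W i, it is at least W i - 1 + d. *)
Lemma spread_of_covering {W : nat -> int} {N d : nat} : (0 < N)%N ->
  (forall z : int, exists2 k, (k < N)%N & (d%:Z %| W k - z)%Z) ->
  exists i j, [/\ (i < N)%N, (j < N)%N & d%:Z - 1 <= `|W j - W i|].
Proof.
case: N => // N _ cover.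
case: (arg_minP (fun i : 'I_N.+1 => W i) (erefl (xpredT ord0))) => i _ minW.
have [j ltjN dvd_j] := cover (W i - 1).
have leW := minW (Ordinal ltjN) isT; rewrite /= in leW.
exists i, j; split=> //.
have/dvdzP[q Eq] := dvd_j.
have {}leW : (W i <= W j)%R by [].
have q_gt0 : 0 < q by nia.
have : d%:Z <= q * d%:Z by rewrite ler_peMl //; lia.
lia.
Qed.

(** * The circlet cost as a distance to a vertex or to its antipode *)

(** For i <= d these are the circlet coefficients. *)
Definition circlet_cost (d i : nat) : nat := if odd i then i else (d - i)%N.

(** The representative of least absolute value, modulo 2d, of D when D is odd
    and of D + d when D is even, for |D| < 2d. *)
Definition antipodal_step (d : nat) (D : int) : int :=
  if odd `|D| then
    if (`|D| <= d)%N then D else if 0 <= D then D - (2 * d)%:Z else D + (2 * d)%:Z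
  else if 0 <= D then D - d%:Z else D + d%:Z.

Lemma norm_antipodal_step (d : nat) (D : int) : (`|D| < 2 * d)%N ->
  `|antipodal_step d D| =
    (circlet_cost d (minn `|D| (2 * d - `|D|)%N))%:Z :> int.
Proof.
move=> ltD; rewrite /antipodal_step /circlet_cost.
have -> : odd (minn `|D| (2 * d - `|D|)) = odd `|D|.
  rewrite /minn; case: ifP => // _.
  (* Complementing to the even number 2d preserves parity. *)
  by rewrite oddB ?(ltnW ltD) // oddM.
by case: (odd `|D|); do ?case: ifP; lia.
Qed.

(** Modulo 2d, if D is even then d D vanishes and the affine expression is
    D + d; if D is odd then d D + d vanishes and D remains. This uniform affine
    form is what makes the steps telescope, with no bookkeeping of parities. *)
Lemma antipodal_step_mod (d : nat) (D : int) :
  ((2 * d)%:Z %| antipodal_step d D - ((1 + d%:Z) * D + d%:Z))%Z.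
Proof.
apply/dvdzP; rewrite /antipodal_step.
have [m Dm] : exists m : int, D = 2 * m + (odd `|D|)%:Z.
  have := odd_double_half `|D|; move: (half _) => h.
  case: (odd _) => /= Dhalf.
    by exists (if 0 <= D then h%:Z else - h.+1%:Z); case: ifP; lia.
  by exists (if 0 <= D then h%:Z else - h%:Z); case: ifP; lia.
case: ifP Dm => _ /= Dm; last first; rewrite ?addr0 in Dm.
  by exists (if 0 <= D then - m - 1 else - m); case: ifP => _;
    rewrite PoszM Dm; ring.
by exists (- m - 1 + (if (`|D| <= d)%N then 0 else if 0 <= D then -1 else 1));
  do 2?case: ifP => _; rewrite PoszM Dm; ring.
Qed.

(** The core estimate: the steps are summed to a walk, which either closes up
    only modulo 2d, and then is long because its displacement is, or really
    closes up, and then is long because it covers all classes modulo d. *)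
Lemma covering_tour_cost {d : nat} {v : nat -> int} : (0 < d)%N ->
  v (2 * d)%N = v 0%N ->
  (forall z : int, exists2 k, (k < 2 * d)%N & (d%:Z %| v k - z)%Z) ->
  (2 * d - 2)%:Z <=
    \sum_(0 <= k < 2 * d) `|antipodal_step d (v k.+1 - v k)|.
Proof.
move=> d_gt0 closedv cover.
pose W k : int := \sum_(0 <= i < k) antipodal_step d (v i.+1 - v i).
have WS k : W k.+1 - W k = antipodal_step d (v k.+1 - v k).
  by rewrite /W big_nat_recr //= addrAC subrr add0r.
have W0 : W 0%N = 0 by rewrite /W big_geq.
have Wmod k : ((2 * d)%:Z %| W k - ((1 + d%:Z) * (v k - v 0%N) + d%:Z * k%:Z))%Z.
  elim: k => [|k IHk]; first by rewrite W0 (_ : _ - _ = 0) ?dvdz0 //; ring.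
  have := rpredD IHk (antipodal_step_mod d (v k.+1 - v k)); rewrite -WS.
  congr (_ %| _)%Z; rewrite -[k.+1]addn1 PoszD; ring.
under eq_bigr => k _ do rewrite -WS.
have [closedW | openW] := eqVneq (W (2 * d)%N) (W 0%N).
  have coverW z : exists2 k, (k < 2 * d)%N & (d%:Z %| W k - z)%Z.
    have [k ltk dvdk] := cover (z + v 0%N); exists k => //.
    have/dvdzP[q Eq] := Wmod k; have/dvdzP[q' Eq'] := dvdk.
    (* W k - z = (W k - affine part) + d (v k - v 0 + k) + (v k - (z + v 0)),
       and d divides each of the three summands. *)
    apply/dvdzP; exists (q * 2 + (v k - v 0%N) + k%:Z + q').
    move: Eq Eq'; rewrite PoszM; lia.
  have [|i [j [lti ltj spread]]] := spread_of_covering _ coverW; first by lia.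
  apply: le_trans (closed_walk_length_ge closedW (ltnW lti) (ltnW ltj)).
  lia.
have := telescope_norm W (leq0n (2 * d)%N).
apply: le_trans; have/dvdzP[q] := Wmod (2 * d)%N.
(* The affine part at k = 2d is d (2d), which is itself divisible by 2d. *)
rewrite closedv subrr mulr0 add0r W0 subr0 => /eqP.
rewrite subr_eq -mulrDl => /eqP DW.
have : q + d%:Z != 0 by apply: contraNneq openW => q0; rewrite W0 DW q0 mul0r.
rewrite DW normrM; nia.
Qed.

(** * Hamiltonian cycles and their edges *)

Lemma vertex_distC {n} (i j : 'I_n) : vertex_dist i j = vertex_dist j i.
Proof. by rewrite /vertex_dist; lia. Qed.

Lemma has_lengthE {n} {e : edge n} {u v : 'I_n} (k : nat) :
  val e = [set u; v] -> has_length e k = (vertex_dist u v == k).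
Proof.
move=> De; apply/idP/idP => [/existsP[i /existsP[j]]|distk]; last first.
  by apply/existsP; exists u; apply/existsP; exists v; rewrite De eqxx.
rewrite De => /andP[/eqP/setP eq_uv /eqP <-].
have : (i == u) || (i == v) by rewrite -in_set2 eq_uv set21.
have : (j == u) || (j == v) by rewrite -in_set2 eq_uv set22.
have : (u == i) || (u == j) by rewrite -in_set2 -eq_uv set21.
have : (v == i) || (v == j) by rewrite -in_set2 -eq_uv set22.
move=> v_ij u_ij /orP[]/eqP Dj /orP[]/eqP Di; subst i j.
- by move: v_ij; rewrite orbb => /eqP->.
- by rewrite vertex_distC.
- by [].
- by move: u_ij; rewrite orbb => /eqP->.
Qed.

Lemma vertex_dist_gt0 {n} {u v : 'I_n} : u != v -> (0 < vertex_dist u v)%N.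
Proof. by case: u v => [u ltu] [v ltv]; rewrite /vertex_dist -val_eqE /=; lia. Qed.

Lemma vertex_dist_le_half {n} (u v : 'I_n) : (vertex_dist u v <= n %/ 2)%N.
Proof. by rewrite /vertex_dist; lia. Qed.

(** The edges of H are indexed by the vertices, v giving the edge from v to its
    successor. Distinct vertices give distinct edges because the cycle has
    more than two vertices: otherwise v and its successor would follow each
    other. *)
Lemma length_weight_tour {R : realType} {n : nat} {p : seq 'I_n} {H : {set edge n}}
    (k : nat) :
  (2 < size p)%N -> ucycle (@complete_graph n) p -> (forall v, v \in p) ->
  H = [set e : edge n | [exists v : 'I_n, val e == [set v; next p v]]] ->
  length_weight (incidence R H) k =
    \sum_(v : 'I_n) (vertex_dist v (next p v) == k)%:R.
Proof.
move=> size_p /andP[cycle_p uniq_p] p_all DH.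
have card_edge v : #|[set v; next p v]| == 2%N.
  have : v != next p v := next_cycle cycle_p (p_all v).
  by rewrite cards2 => ->.
pose tour_edge v : edge n := Sub [set v; next p v] (card_edge v).
have next2_neq v : next p (next p v) != v.
  have [i q Dq] := rot_to (p_all v).
  rewrite -!(next_rot i uniq_p) Dq.
  move: size_p uniq_p; rewrite -(size_rot i) -(rot_uniq i) Dq.
  case: q {Dq} => [|a [|b q]] //= _.
  rewrite !inE !negb_or eqxx => /andP[/and3P[va vb _] _].
  by rewrite [a == v]eq_sym (negPf va) eqxx eq_sym.
have tour_edge_inj : injective tour_edge.
  move=> u v /(congr1 val)/= /setP eq_uv.
  have := (eq_uv u, eq_uv v); rewrite !inE !eqxx /=.
  case: (eqVneq u v) => //= _ [/esym/eqP Du /eqP Dv].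
  by have := next2_neq v; rewrite -Du -Dv eqxx.
have -> : H = [set tour_edge v | v in 'I_n].
  apply/setP=> e; rewrite DH inE; apply/existsP/imsetP => [[v /eqP De]|[v _ ->]].
    by exists v => //; apply: val_inj.
  by exists v; rewrite /= eqxx.
rewrite /length_weight; under eq_bigr do rewrite ffunE.
rewrite [LHS]big_mkcond /= [RHS]big_mkcond /=.
rewrite (bigID (mem [set tour_edge v | v in 'I_n])) /= addrC big1 ?add0r.
  rewrite big_imset //=; last by move=> u v _ _; exact: tour_edge_inj.
  apply: eq_bigr => v _; rewrite imset_f //.
  rewrite (has_lengthE (u := v) (v := next p v)) //.
  by case: eqP.
by move=> e /negPf->; case: ifP.
Qed.

(** For the last index, [nth] runs past the end and returns its default x0,
    which is precisely the successor of the last entry on the cycle. *)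
Lemma next_nth_uniq {T : eqType} (x0 : T) (p : seq T) (k : nat) : uniq (x0 :: p) ->
  (k < size (x0 :: p))%N ->
  next (x0 :: p) (nth x0 (x0 :: p) k) = nth x0 (x0 :: p) k.+1.
Proof.
by move=> uniq_p ltk; rewrite next_nth mem_nth // index_uniq.
Qed.

Lemma tour_cost_ge {n d : nat} {p : seq 'I_n} : n = (2 * d)%N -> (0 < d)%N ->
  uniq p -> (forall v, v \in p) ->
  (2 * d - 2 <= \sum_(v : 'I_n) circlet_cost d (vertex_dist v (next p v)))%N.
Proof.
move=> Dn d_gt0 uniq_p p_all.
have size_p : size p = (2 * d)%N.
  rewrite -(card_uniqP uniq_p) -Dn -[RHS]card_ord.
  by apply: eq_card => v; rewrite p_all.
have -> : (\sum_(v : 'I_n) circlet_cost d (vertex_dist v (next p v)) =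
           \sum_(v <- p) circlet_cost d (vertex_dist v (next p v)))%N.
  by rewrite (big_uniq _ uniq_p) /=; apply: eq_bigl => v; rewrite p_all.
case: p => [|x0 p'] in uniq_p p_all size_p *; first by rewrite /= in size_p; lia.
set p := x0 :: p' in uniq_p p_all size_p *.
(* With default x0, v (2 * d) is v 0, so v is already the closed tour. *)
pose v k : int := (nth x0 p k : nat)%:Z.
rewrite (big_nth x0) size_p -lez_nat.
have closedv : v (2 * d)%N = v 0%N by rewrite /v nth_default ?size_p.
have cover z : exists2 k, (k < 2 * d)%N & (d%:Z %| v k - z)%Z.
  have ltz : (`|(z %% d)%Z| < n)%N by lia.
  exists (index (Ordinal ltz) p); first by rewrite -size_p index_mem p_all.
  rewrite /v nth_index ?p_all //=; apply/dvdzP; exists (- (z %/ d)%Z).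
  have := divz_eq z d; have := modz_ge0 z (d := d).
  lia.
apply: le_trans (covering_tour_cost d_gt0 closedv cover) _.
rewrite (big_morph Posz PoszD (erefl (0%:Z))).
rewrite le_eqVlt; apply/orP; left; apply/eqP/eq_big_nat => k /andP[_ ltk].
rewrite next_nth_uniq ?size_p // /v.
move: (nth x0 p k) (nth x0 p k.+1) => [a lta] [b ltb].
rewrite norm_antipodal_step /vertex_dist /=; last by lia.
by rewrite distnC Dn.
Qed.

(** * The circlet inequality *)

Lemma circlet_coefE (R : realType) (d i : nat) : (i <= d)%N ->
  circlet_coef R d i = (circlet_cost d i)%:R.
Proof.
by rewrite /circlet_coef /circlet_cost => le_id; case: ifP; rewrite ?natrB.
Qed.

Lemma tour_circlet_ge (R : realType) (n : nat) (H : {set edge n}) :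
  (0 < n)%N -> (2 %| n)%N -> hamiltonian_cycle H ->
  n%:R - 2 <= \sum_(1 <= i < (n %/ 2).+1)
    circlet_coef R (n %/ 2) i * length_weight (incidence R H) i.
Proof.
move=> n_gt0 n_even [p [size_p ucycle_p p_all DH]].
have [cycle_p uniq_p] := andP ucycle_p.
set d := (n %/ 2)%N; have Dn : n = (2 * d)%N by rewrite mulnC divnK.
have d_gt0 : (0 < d)%N by lia.
(* Every edge has exactly one length, and it lies between 1 and d, so summing
   over lengths charges each edge once. *)
have -> : \sum_(1 <= i < d.+1) circlet_coef R d i * length_weight (incidence R H) i
   = (\sum_(v : 'I_n) circlet_cost d (vertex_dist v (next p v)))%:R.
  under eq_bigr do rewrite (length_weight_tour _ size_p ucycle_p p_all DH) mulr_sumr.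
  rewrite exchange_big /= natr_sum; apply: eq_bigr => v _.
  have dist_gt0 : (0 < vertex_dist v (next p v))%N.
    by apply: vertex_dist_gt0; exact: next_cycle cycle_p (p_all v).
  have dist_le := vertex_dist_le_half v (next p v).
  rewrite (bigD1_seq (vertex_dist v (next p v))) ?iota_uniq //=; last first.
    by rewrite mem_index_iota dist_gt0 ltnS.
  rewrite eqxx mulr1 circlet_coefE // big1 ?addr0 // => i /negPf.
  by rewrite eq_sym => ->; rewrite mulr0.
have := tour_cost_ge Dn d_gt0 uniq_p p_all.
by rewrite -(ler_nat R) natrB -?Dn // dvdn_leq.
Qed.

Theorem theorem3p1 (R : realType) (n : nat) (n_gt0 : (0 < n)%N)
    (dvd4n : (4 %| n)%N) (x : edge_vector R n) (xP : @STSP R n x) :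
  n%:R - 2 <=
    \sum_(1 <= i < (n %/ 2).+1)
       circlet_coef R (n %/ 2) i * length_weight x i.
Proof.
have n_even : (2 %| n)%N by apply: dvdn_trans dvd4n.
case: xP => m [a [v [a_ge0 sum_a v_tour ->]]].
(* Linearity reduces the bound to incidence vectors of Hamiltonian cycles. *)
have -> : \sum_(1 <= i < (n %/ 2).+1) circlet_coef R (n %/ 2) i *
            length_weight (\sum_(j < m) a j *: v j) i =
          \sum_(j < m) a j * \sum_(1 <= i < (n %/ 2).+1)
            circlet_coef R (n %/ 2) i * length_weight (v j) i.
  under [RHS]eq_bigr do rewrite mulr_sumr.
  rewrite exchange_big /=; apply: eq_bigr => i _.
  under [RHS]eq_bigr do rewrite mulrCA.
  rewrite -mulr_sumr; congr (_ * _); rewrite /length_weight.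
  under [RHS]eq_bigr do rewrite mulr_sumr.
  rewrite exchange_big /=; apply: eq_bigr => e _.
  by rewrite sum_ffunE; apply: eq_bigr => j _; rewrite ffunE.
have -> : n%:R - 2 = \sum_(j < m) a j * (n%:R - 2) :> R.
  by rewrite -mulr_suml sum_a mul1r.
apply: ler_sum => j _.
apply: ler_wpM2l => //; have [H tourH ->] := v_tour j.
exact: tour_circlet_ge.
Qed.
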